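(* Let $d\ge 3$ and let $G$ be a $d$-regular graph of girth $g(G)\ge 7$. Then $G$ realizes the sequence $(2^{d+1})$, i.e. the constant sequence of length $d+1$ all of whose terms equal $2$.
   Context: Graphs are finite, simple and connected. The girth $g(G)$ is the length of a shortest cycle of $G$. Given a proper coloring of $G$, a vertex $v$ is a color-dominating vertex (CDV) if its closed neighborhood $N[v]$ contains all colors used in the coloring. A b-coloring is a proper coloring in which every color class contains at least one CDV. $G$ realizes a finite non-increasing sequence $(s_1,\dots,s_k)$ of positive integers if $G$ has a b-coloring with exactly $k$ colors in which, for each $i\in\{1,\dots,k\}$, the $i$th color class contains at least $s_i$ CDVs. *)

(* Defs.v *)
From mathcomp Require Import all_boot.

Set Implicit Arguments.
Unset Strict Implicit.
Unset Printing Implicit Defensive.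

(* A graph is a finite type of vertices with an adjacency relation [e : rel T];
   it is simple when [e] is symmetric and irreflexive. *)

Section Graph.

Variables (T : finType) (e : rel T).

Definition simple_graph : Prop := symmetric e /\ irreflexive e.

(* The null graph is not connected. *)
Definition connected_graph : Prop :=
  0 < #|T| /\ forall x y : T, connect e x y.

Definition open_nbhd (v : T) : {set T} := [set w | e v w].

Definition closed_nbhd (v : T) : {set T} := v |: open_nbhd v.

Definition regular_graph (d : nat) : Prop := forall v : T, #|open_nbhd v| = d.

(* [ucycle] accepts sequences of length at most 2 (in particular x, y for an
   edge xy), hence the bound on the length. *)
Definition graph_cycle (p : seq T) : Prop := 2 < size p /\ ucycle e p.

(* A relation rather than a function: an acyclic graph has no girth in nat. *)
Definition is_girth (g : nat) : Prop :=
  (exists p, graph_cycle p /\ size p = g) /\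
  (forall p, graph_cycle p -> g <= size p).

Section Coloring.

Variables (C : finType) (c : {ffun T -> C}).

Definition proper_coloring : Prop := forall x y : T, e x y -> c x != c y.

Definition used_colors : {set C} := [set c v | v : T].

Definition color_class (a : C) : {set T} := [set v | c v == a].

Definition cdv (v : T) : bool := used_colors \subset [set c w | w in closed_nbhd v].

Definition b_coloring : Prop :=
  proper_coloring /\
  forall a : C, a \in used_colors -> exists2 v, v \in color_class a & cdv v.

End Coloring.

Definition positive_nonincreasing (s : seq nat) : bool :=
  sorted geq s && all (leq 1) s.

Definition realizes (s : seq nat) : Prop :=
  positive_nonincreasing s /\
  exists c : {ffun T -> 'I_(size s)},
    [/\ b_coloring c,
        used_colors c = [set: 'I_(size s)] &
        forall i : 'I_(size s),
          nth 0 s i <= #|[set v in color_class c i | cdv c v]|].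

End Graph.

(* Main.v *)
Require Import Defs.
From mathcomp Require Import all_boot.

(** Any proper partial coloring with d+1 colors extends greedily, so it is
    enough to color part of the graph so that every color has two vertices
    whose closed neighborhoods are already rainbow.  Take an edge [r false],
    [r true].  Give the roots two colors [a s], and let the other neighbors of
    each root carry the remaining d-1 colors; once the children of these
    neighbors are colored suitably, each of the d-1 colors has two dominating
    vertices and each [a s] has one.  The second one for [a s] is a
    grandchild [w (~~ s)] of the opposite root, whose parent [q (~~ s)] has
    color [b (~~ s)], where [b false] and [b true] differ, and [w false],
    [w true] have no common neighbor.  Girth at least 7 makes the colored
    region a tree up to at most one edge between the children of [w false] and
    those of [w true], and at most one edge from the children of [w s] to the
    children of each neighbor of [r (~~ s)]; these few edges are handled by
    choosing the bijections between children and missing colors. *)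

Set Implicit Arguments.
Unset Strict Implicit.
Unset Printing Implicit Defensive.

(** * Bijections between finite sets, with prescribed values *)

Section FiniteBijections.

Variables T C : finType.
Implicit Types (S : {set T}) (L : {set C}).

Definition bij_between (f : T -> C) S L : Prop :=
  {in S &, injective f} /\ f @: S = L.

Lemma bij_between_mem f S L t : bij_between f S L -> t \in S -> f t \in L.
Proof. by case=> _ <- tS; apply: imset_f. Qed.

Lemma bij_between_onto f S L k :
  bij_between f S L -> k \in L -> exists2 t, t \in S & f t = k.
Proof. by case=> _ <- /imsetP[t tS ->]; exists t. Qed.

Lemma bij_between_extend f S L s k :
    s \in S -> k \in L -> bij_between f (S :\ s) (L :\ k) ->
  bij_between [eta f with s |-> k] S L.
Proof.
move=> sS kL fSL.
have fk t : t \in S -> t != s -> f t \in L :\ k.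
  by move=> tS ts; apply: (bij_between_mem fSL); rewrite !inE ts.
split=> [x y xS yS /=|].
  case: (eqVneq x s) => [->|xs]; case: (eqVneq y s) => [->|ys] //.
  - by move=> kE; move: (fk y yS ys); rewrite -kE !inE eqxx.
  - by move=> kE; move: (fk x xS xs); rewrite kE !inE eqxx.
  - by case: fSL => f_inj _; apply: f_inj; rewrite !inE ?xs ?ys.
apply/setP=> j; apply/imsetP/idP=> [[t tS ->] /=|jL].
  by case: eqVneq => // ts; move: (fk t tS ts); rewrite !inE => /andP[].
case: (eqVneq j k) => [->|jk]; first by exists s => //=; rewrite eqxx.
have /(bij_between_onto fSL)[t] : j \in L :\ k by rewrite !inE jk.
by rewrite !inE => /andP[/negPf ts tS] <-; exists t; rewrite //= ts.
Qed.

Lemma cardsD1_eq S L s k :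
  #|S| = #|L| -> s \in S -> k \in L -> #|S :\ s| = #|L :\ k|.
Proof.
by rewrite (cardsD1 s S) (cardsD1 k L) => SL sS kL; move: SL; rewrite sS kL => -[].
Qed.

Lemma bij_between_exists (k0 : C) S L : #|S| = #|L| ->
  exists f, bij_between f S L.
Proof.
move nE: #|S| => n; elim: n S L nE => [|n IH] S L nS nL.
  (* Both sets are empty here; [k0] only provides some function into [C]. *)
  exists (fun=> k0); rewrite (cards0_eq nS) (cards0_eq (esym nL)).
  by split=> [x|]; rewrite ?inE ?imset0.
have /card_gt0P[s sS] : 0 < #|S| by rewrite nS.
have /card_gt0P[k kL] : 0 < #|L| by rewrite -nL.
have [||f fSL] := IH (S :\ s) (L :\ k).
- by move: nS; rewrite (cardsD1 s) sS => -[].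
- by move: nL; rewrite (cardsD1 k) kL => -[].
by exists [eta f with s |-> k]; apply: bij_between_extend.
Qed.

Lemma bij_between_exists1 S L s k : #|S| = #|L| -> s \in S -> k \in L ->
  exists2 f, bij_between f S L & f s = k.
Proof.
move=> SL sS kL.
have [|f fSL] := @bij_between_exists k (S :\ s) (L :\ k).
  exact: cardsD1_eq.
by exists [eta f with s |-> k]; [apply: bij_between_extend | rewrite /= eqxx].
Qed.

Lemma bij_between_exists2 S L s1 s2 k1 k2 :
    #|S| = #|L| -> s1 \in S -> s2 \in S -> s1 != s2 ->
    k1 \in L -> k2 \in L -> k1 != k2 ->
  exists f, [/\ bij_between f S L, f s1 = k1 & f s2 = k2].
Proof.
move=> SL s1S s2S s12 k1L k2L k12.
have [||| f fSL fs2] := @bij_between_exists1 (S :\ s1) (L :\ k1) s2 k2.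
- exact: cardsD1_eq.
- by rewrite !inE eq_sym s12.
- by rewrite !inE eq_sym k12.
exists [eta f with s1 |-> k1]; split; first exact: bij_between_extend.
  by rewrite /= eqxx.
by rewrite /= eq_sym (negPf s12).
Qed.

(** The [A]-element of [S] takes [k1], and a [B]-element distinct from it takes [k2]. If the two
    coincide, or if there is no [A]-element, the [B]-element takes [k1]. *)
Lemma bij_between_prescribed S L (A B : pred T) k1 k2 :
    #|S| = #|L| -> k1 \in L -> k2 \in L -> k1 != k2 ->
    {in S &, forall s t, A s -> A t -> s = t} ->
    {in S &, forall s t, B s -> B t -> s = t} ->
  exists f, [/\ bij_between f S L, {in S, forall s, A s -> f s = k1}
    & {in S, forall s, B s -> f s \in pred2 k1 k2}].
Proof.
move=> SL k1L k2L k12 A1 B1.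
case: (pickP [predI S & A]) => [s1 /= /andP[s1S As1]|noA].
- case: (pickP [pred t in S | B t && (t != s1)]) => [s2|noB].
    case/and3P=> s2S Bs2; rewrite eq_sym => s12.
    have [f [fSL fs1 fs2]] := bij_between_exists2 SL s1S s2S s12 k1L k2L k12.
    exists f; split=> // t tS; first by move/(A1 t s1 tS s1S)->.
    by move/(B1 t s2 tS s2S)->; rewrite // fs2 !inE eqxx orbT.
  have [f fSL fs1] := bij_between_exists1 SL s1S k1L.
  exists f; split=> // t tS; first by move/(A1 t s1 tS s1S)->.
  move=> Bt; move: (noB t); rewrite /= tS Bt /= => /negbFE/eqP->.
  by rewrite fs1 !inE eqxx.
- have noAt t : t \in S -> A t -> False by move=> tS At; have /andP[] := noA t.
  case: (pickP [predI S & B]) => [s2 /= /andP[s2S Bs2]|noB].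
    have [f fSL fs2] := bij_between_exists1 SL s2S k1L.
    exists f; split=> // t tS; first by move/(noAt t tS).
    by move/(B1 t s2 tS s2S)->; rewrite // fs2 !inE eqxx.
  have [f fSL] := bij_between_exists k1 SL.
  exists f; split=> // t tS; first by move/(noAt t tS).
  by move=> Bt; have /andP[] := noB t.
Qed.

End FiniteBijections.

(** * Greedy completion of a partial coloring *)

Section GreedyExtension.

Variables (T C : finType) (e : rel T).
Hypotheses (e_sym : symmetric e) (e_irr : irreflexive e).
Hypothesis few_nbrs : forall v, #|open_nbhd e v| < #|C|.

(** Induction on the number of uncolored vertices: a vertex has fewer neighbors than there are
    colors, so some color is free for it. A relation, rather than a partial function, makes it easy
    to unite several families of assignments. *)
Lemma greedy_extension (col : T -> C -> bool) :
    (forall t k k', col t k -> col t k' -> k = k') ->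
    (forall t t' k, e t t' -> col t k -> col t' k -> False) ->
  exists2 c : {ffun T -> C}, proper_coloring e c &
    forall t k, col t k -> c t = k.
Proof.
have [n] := ubnP #|[set t | ~~ [exists k, col t k]]|.
elim: n col => // n IH col le_n col_fun col_proper.
case: (pickP [pred t | ~~ [exists k, col t k]]) => [v /= v_uncol|all_col].
  have [k0 k0_free] : exists k0, forall t, e v t -> ~~ col t k0.
    have /card_gt0P[kd _] : 0 < #|C| by apply: leq_trans (few_nbrs v).
    (* [kd] stands in for uncolored neighbors; the image is still no larger than the neighborhood,
       so it misses a color. *)
    pose f t := odflt kd [pick j | col t j].
    have /subsetPn[k0 _ k0_free] : ~~ ([set: C] \subset f @: open_nbhd e v).
      apply/negP => /subset_leq_card; rewrite cardsT leqNgt => /negP; apply.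
      exact: leq_ltn_trans (leq_imset_card _ _) (few_nbrs v).
    exists k0 => t vt; apply: contra k0_free => tk0.
    apply/imsetP; exists t; rewrite ?inE // /f.
    by case: pickP => [j tj|/(_ k0)]; [apply: (col_fun t) | rewrite tk0].
  pose col' t k := col t k || ((t == v) && (k == k0)).
  have v_nocol k : col v k = false.
    by apply/negbTE; apply: contra v_uncol => vk; apply/existsP; exists k.
  have [||| c c_proper c_col] := IH col'.
  - rewrite -ltnS (leq_trans _ le_n) // ltnS; apply: proper_card.
    apply/properP; split; last first.
      exists v; rewrite inE // negbK; apply/existsP; exists k0.
      by rewrite /col' !eqxx orbT.
    apply/subsetP=> t; rewrite !inE; apply: contra => /existsP[k tk].
    by apply/existsP; exists k; rewrite /col' tk.
  - move=> t k k' /orP[tk|/andP[/eqP-> /eqP->]] /orP[tk'|/andP[/eqP tv /eqP->]] //.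
    + exact: (col_fun t).
    + by move: tk; rewrite tv v_nocol.
    + by rewrite v_nocol in tk'.
  - move=> t t' k tt' /orP[tk|/andP[/eqP tv /eqP kE]].
      case/orP=> [t'k|/andP[/eqP t'v /eqP kE]]; first exact: (col_proper t t' k).
      by move: (k0_free t); rewrite e_sym -t'v tt' -kE tk => /(_ isT).
    case/orP=> [t'k|/andP[/eqP t'v _]].
      by move: (k0_free t'); rewrite -tv tt' -kE t'k => /(_ isT).
    by rewrite tv t'v e_irr in tt'.
  by exists c => // t k tk; apply: c_col; rewrite /col' tk.
have has_col t : exists k, col t k by apply/existsP/negbFE/all_col.
pose c := [ffun t => xchoose (has_col t)].
have cP t : col t (c t) by rewrite ffunE; apply: xchooseP.
exists c => [x y xy|t k tk]; last exact: (col_fun t).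
by apply/negP => /eqP cxy; apply: (col_proper _ _ (c x) xy); rewrite // cxy.
Qed.

End GreedyExtension.

(** * Non-backtracking walks shorter than the girth *)

Section LargeGirth.

Variables (T : finType) (e : rel T) (g : nat).
Hypotheses (e_sym : symmetric e) (e_irr : irreflexive e).
Hypothesis long_cycles : forall p, graph_cycle e p -> g <= size p.

(* The walk [x, y, s] does not backtrack. Short ones cannot revisit a vertex. *)
Fixpoint nb_walk x y s : bool :=
  e x y && (if s is z :: s' then (x != z) && nb_walk y z s' else true).

Lemma nb_walk_path x y s : nb_walk x y s -> path e x (y :: s).
Proof.
elim: s x y => [|z s IH] x y /= => [->//|/and3P[-> _]].
exact: IH.
Qed.

(** By induction the tail has no repetition, so a return to [x] closes a cycle; it has at most
    [size s + 1] edges, fewer than [g]. *)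
Lemma nb_walk_uniq x y s : nb_walk x y s -> size s + 1 < g ->
  uniq [:: x, y & s].
Proof.
elim: s x y => [|z s IH] x y.
  rewrite /= andbT inE => xy _; rewrite andbT.
  by apply: contraTneq xy => ->; rewrite e_irr.
move=> nbw; have /= /and3P[xy xz nbw'] := nbw; rewrite addSn => lt_g.
have yzs : uniq [:: y, z & s] by apply: IH => //; apply: ltnW.
apply/andP; split; last exact: yzs.
apply/negP; rewrite inE.
have xy_neq : x != y by apply: contraTneq xy => ->; rewrite e_irr.
rewrite (negPf xy_neq) orFb => x_in.
have [p1 [p2 def]] : exists p1 p2, z :: s = p1 ++ x :: p2.
  by case/splitPr: x_in => p1 p2; exists p1, p2.
(* An empty [p1] would be a backtrack; hence the cycle has at least three vertices. *)
case: p1 def => [[zx]|a p1 [_ def]]; first by rewrite zx eqxx in xz.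
have: graph_cycle e (x :: y :: z :: p1).
  split=> //; apply/andP; split; last first.
    move: yzs; rewrite def -!cat_cons cat_uniq => /and3P[yz_uniq].
    by rewrite /= negb_or => /andP[x_nin _] _; apply/andP.
  have := nb_walk_path nbw.
  by rewrite def -!cat_cons -cat_rcons cat_path => /andP[].
move/long_cycles; rewrite leqNgt => /negP; apply; apply: leq_trans lt_g.
by rewrite def /= addn1 size_cat /= addnS !ltnS leq_addr.
Qed.

(** An edge back to [x] would close a cycle on [(size s).+3] vertices. *)
Lemma nb_walk_nadj x y z s : nb_walk x y (z :: s) -> (size s).+3 < g ->
  ~~ e x (last z s).
Proof.
move=> nbw lt_g; apply/negP => xz.
have uniq_s : uniq [:: x, y, z & s].
  by apply: nb_walk_uniq nbw _; rewrite /= addn1; apply: ltnW.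
have /long_cycles : graph_cycle e [:: x, y, z & s].
  split=> //; rewrite /ucycle uniq_s andbT /cycle rcons_path.
  by rewrite nb_walk_path //= e_sym.
by rewrite leqNgt /= lt_g.
Qed.

End LargeGirth.

(** * Short walks when the girth is at least seven *)

Section LocalStructure.

Variables (T : finType) (e : rel T) (g : nat).
Hypotheses (e_sym : symmetric e) (e_irr : irreflexive e).
Hypothesis long_cycles : forall p, graph_cycle e p -> g <= size p.
Hypothesis g_ge7 : 7 <= g.

(** In the tree picture, the children of [y] when [x] is its parent. *)
Definition branch x y : {set T} := open_nbhd e y :\ x.

Lemma in_branch x y t : (t \in branch x y) = (t != x) && e y t.
Proof. by rewrite !inE. Qed.

(** The bound allows walks of at most six edges. *)
Lemma nb_walk_neq x y s : nb_walk e x y s -> size s < 6 -> x != last y s.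
Proof.
move=> nbw le6.
have := nb_walk_uniq e_irr long_cycles nbw _.
rewrite addn1 (leq_trans _ g_ge7) // => /(_ isT) /andP[x_nin _].
by apply: contraNneq x_nin => ->; apply: mem_last.
Qed.

(** The bound allows at most five edges, so a closing edge would give a cycle of length at most
    six. *)
Lemma nb_walk_nedge x y z s : nb_walk e x y (z :: s) -> size s < 4 ->
  ~~ e x (last z s).
Proof.
move=> nbw le4; apply: (nb_walk_nadj e_sym e_irr long_cycles nbw).
exact: leq_trans g_ge7.
Qed.

Ltac nbw := rewrite /=; repeat (apply/andP; split);
  first [done | by rewrite e_sym | by rewrite eq_sym].

(** Two such paths from [p] to [w] that differ in one inner vertex give a 4-cycle; if they differ in
    both, they give a 6-cycle. *)
Lemma path3_unique p t y w t' y' :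
    e p t -> e t y -> e y w -> e p t' -> e t' y' -> e y' w ->
    p != y -> p != y' -> t != w -> t' != w ->
  t = t' /\ y = y'.
Proof.
move=> pt ty yw pt' ty' yw' py py' tw tw'.
case: (eqVneq t t') => [tt'|tt']; case: (eqVneq y y') => [yy'|yy'] //; exfalso.
- have /nb_walk_nedge/= /(_ isT) : nb_walk e y w [:: y'; t] by rewrite tt'; nbw.
  by rewrite e_sym ty.
- have /nb_walk_nedge/= /(_ isT) : nb_walk e t p [:: t'; y] by rewrite yy'; nbw.
  by rewrite ty.
- have /nb_walk_nedge/= /(_ isT) : nb_walk e t p [:: t'; y'; w; y] by nbw.
  by rewrite ty.
Qed.

(** * Edges between the two sides of the tree grown from the root edge *)

Section Skeleton.

Variables r q w : bool -> T.
Hypothesis r_edge : forall s, e (r s) (r (~~ s)).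
Hypothesis q_in : forall s, q s \in branch (r (~~ s)) (r s).
Hypothesis w_in : forall s, w s \in branch (r s) (q s).

(* The next facts are not named below: [nbw] finds them through [done]. *)
Let rq s : e (r s) (q s).
Proof. by have := q_in s; rewrite in_branch => /andP[]. Qed.
Let qr' s : q s != r (~~ s).
Proof. by have := q_in s; rewrite in_branch => /andP[]. Qed.
Let qw s : e (q s) (w s).
Proof. by have := w_in s; rewrite in_branch => /andP[]. Qed.
Let wr s : w s != r s.
Proof. by have := w_in s; rewrite in_branch => /andP[]. Qed.
Let rq' s : r s != q (~~ s).
Proof. by rewrite eq_sym; have := qr' (~~ s); rewrite negbK. Qed.

Lemma grandchild_far s p t : p \in branch (r (~~ s)) (r s) ->
  t \in branch (r s) p -> t != w (~~ s).
Proof.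
rewrite !in_branch => /andP[pr' rp] /andP[tr pt].
have := @nb_walk_neq t p [:: r s; r (~~ s); q (~~ s); w (~~ s)].
apply=> //; nbw.
Qed.

Lemma child_far s p y : p \in branch (r (~~ s)) (r s) ->
  y \in branch (q (~~ s)) (w (~~ s)) -> p != y.
Proof.
rewrite !in_branch => /andP[pr' rp] /andP[yq wy].
have := @nb_walk_neq p (r s) [:: r (~~ s); q (~~ s); w (~~ s); y].
apply=> //; nbw.
Qed.

(** Both edges extend to paths of length three from [p] to [w (~~ s)], so [path3_unique] applies. *)
Lemma branch_edge_unique s p t y t' y' :
    p \in branch (r (~~ s)) (r s) ->
    t \in branch (r s) p -> t' \in branch (r s) p ->
    y \in branch (q (~~ s)) (w (~~ s)) -> y' \in branch (q (~~ s)) (w (~~ s)) ->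
    e t y -> e t' y' ->
  t = t' /\ y = y'.
Proof.
move=> pU tW t'W yY y'Y ty ty'.
have tw := grandchild_far pU tW; have tw' := grandchild_far pU t'W.
have py := child_far pU yY; have py' := child_far pU y'Y.
move: tW t'W yY y'Y; rewrite !in_branch.
case/andP=> _ pt /andP[_ pt'] /andP[_ wy] /andP[_ wy'].
by apply: (@path3_unique p t y (w (~~ s)) t' y') => //; rewrite e_sym.
Qed.

(** An edge would close a 6-cycle through the two roots. *)
Lemma tip_nedge s : ~~ e (w s) (w (~~ s)).
Proof.
have := @nb_walk_nedge (w s) (q s) (r s) [:: r (~~ s); q (~~ s); w (~~ s)].
apply=> //; nbw.
Qed.

(** Both edges give paths of length three between the tips; [tip_nedge] keeps each tip from being a
    child of the other. *)
Lemma tip_edge_unique s y z y' z' :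
    y \in branch (q s) (w s) -> y' \in branch (q s) (w s) ->
    z \in branch (q (~~ s)) (w (~~ s)) -> z' \in branch (q (~~ s)) (w (~~ s)) ->
    e y z -> e y' z' ->
  y = y' /\ z = z'.
Proof.
rewrite !in_branch => /andP[_ wy] /andP[_ wy'] /andP[_ wz] /andP[_ wz'] yz yz'.
have ww := tip_nedge s.
apply: (@path3_unique (w s) y z (w (~~ s)) y' z') => //;
  first [by rewrite e_sym | apply: contraNneq ww].
- by move=> ->; rewrite e_sym.
- by move=> ->; rewrite e_sym.
- by move=> <-.
- by move=> <-.
Qed.

(** If two candidates both shared a neighbor with [w (~~ s)], two edges would join the children of
    [q s] to those of [w (~~ s)], against [branch_edge_unique]. *)
Lemma far_tip_exists s : 1 < #|branch (r s) (q s)| ->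
  exists2 t, t \in branch (r s) (q s) & forall y, e (w (~~ s)) y -> ~~ e t y.
Proof.
case/card_gt1P=> t1 [t2 [t1W t2W t12]].
have common_nbr t y : t \in branch (r s) (q s) -> e (w (~~ s)) y -> e t y ->
    y \in branch (q (~~ s)) (w (~~ s)).
  rewrite !in_branch => /andP[tr qt] wy ty; rewrite wy andbT.
  (* The common neighbor is not [q (~~ s)], as this would close a 5-cycle. *)
  apply: contraTneq ty => ->.
  apply: (@nb_walk_nedge t (q s) (r s) [:: r (~~ s); q (~~ s)]) => //; nbw.
pose close t := [exists y, e (w (~~ s)) y && e t y].
have far t : ~~ close t -> forall y, e (w (~~ s)) y -> ~~ e t y.
  by move=> /existsPn far_t y wy; have := far_t y; rewrite wy.
have [/existsP[y1 /andP[wy1 ty1]]|/far] := boolP (close t1); last by exists t1.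
have [/existsP[y2 /andP[wy2 ty2]]|/far] := boolP (close t2); last by exists t2.
have y1Y := common_nbr _ _ t1W wy1 ty1; have y2Y := common_nbr _ _ t2W wy2 ty2.
have [tE _] := branch_edge_unique (q_in s) t1W t2W y1Y y2Y ty1 ty2.
by rewrite tE eqxx in t12.
Qed.

(** * Existence of suitable colors on the branches *)

Section Existence.

Variables (C : finType) (d : nat).
Hypothesis d_ge3 : 3 <= d.
Hypothesis e_reg : regular_graph e d.
Hypothesis card_C : #|C| = d.+1.

Lemma card_branch x y : e x y -> #|branch x y| = d.-1.
Proof.
by move=> xy; have := e_reg y; rewrite (cardsD1 x) inE e_sym xy => <-.
Qed.

Lemma cardsC2 (k k' : C) : k != k' -> #|~: [set k; k']| = d.-1.
Proof. by move=> kk'; rewrite cardsCs setCK cards2 kk' card_C subn2. Qed.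

(** [ka'] and [kb] are the intended colors of [w s] and [q s]. The colors [ka] and [kb'] are to be
    withheld from the children of the opposite tip, hence safe across an edge to one of them; and
    among the children of [q (~~ s)] only [w (~~ s)] is to have color [ka]. Each kind of edge occurs
    at most once. *)
Lemma exists_tip_children_colors (ka ka' kb kb' : C) s :
    uniq [:: ka; ka'; kb; kb'] ->
  exists f, [/\ bij_between f (branch (q s) (w s)) (~: [set ka'; kb]),
    forall y t, y \in branch (q s) (w s) ->
      t \in branch (r (~~ s)) (q (~~ s)) -> e y t -> f y = ka
  & forall y z, y \in branch (q s) (w s) ->
      z \in branch (q (~~ s)) (w (~~ s)) -> e y z -> f y \in pred2 ka kb'].
Proof.
rewrite /= !inE !negb_or !andbT => /and3P[/and3P[aa' ab ab'] /andP[a'b a'b'] bb'].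
pose A y := [exists t in branch (r (~~ s)) (q (~~ s)), e y t].
pose B y := [exists z in branch (q (~~ s)) (w (~~ s)), e y z].
have [||||||f [f_bij fA fB]] :=
  @bij_between_prescribed T C (branch (q s) (w s)) (~: [set ka'; kb]) A B ka kb'.
- by rewrite card_branch // cardsC2.
- by rewrite !inE negb_or aa'.
- by rewrite !inE negb_or eq_sym a'b' eq_sym.
- by [].
- move=> y y' yY y'Y; rewrite /A => /exists_inP[t tW yt] /exists_inP[t' t'W y't'].
  have := @branch_edge_unique (~~ s) (q (~~ s)) t y t' y' (q_in _) tW t'W.
  by rewrite negbK (e_sym t) (e_sym t') => /(_ yY y'Y yt y't') [].
- move=> y y' yY y'Y; rewrite /B => /exists_inP[z zY yz] /exists_inP[z' z'Y y'z'].
  by have [] := tip_edge_unique yY y'Y zY z'Y yz y'z'.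
exists f; split=> // y t yY tX yt.
  by apply: fA => //; apply/exists_inP; exists t.
by apply: fB => //; apply/exists_inP; exists t.
Qed.

(** With [ka'] the color of the opposite root, [w s] can become the second dominating vertex of that
    color. *)
Lemma exists_grandchild_colors_tip (ka ka' kb : C) s :
    ka != kb -> ka' != ka -> ka' != kb ->
  exists2 f, bij_between f (branch (r s) (q s)) (~: [set ka; kb]) & f (w s) = ka'.
Proof.
move=> ab a'a a'b; apply: bij_between_exists1 => //.
  by rewrite card_branch // cardsC2.
by rewrite !inE negb_or a'a.
Qed.

(** At most one edge joins the children of [p] to those of [w (~~ s)]. Its end below [p] has one
    color to avoid, and [d.-1], at least two, are available. *)
Lemma exists_grandchild_colors (ka kp : C) (fY : T -> C) s p : ka != kp ->
    p \in branch (r (~~ s)) (r s) ->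
  exists2 f, bij_between f (branch (r s) p) (~: [set ka; kp]) &
    forall t y, t \in branch (r s) p -> y \in branch (q (~~ s)) (w (~~ s)) ->
      e t y -> f t != fY y.
Proof.
move=> kap pU; have rp : e (r s) p by move: pU; rewrite in_branch => /andP[].
have card_eq : #|branch (r s) p| = #|~: [set ka; kp]|.
  by rewrite card_branch // cardsC2.
pose A t := [exists y in branch (q (~~ s)) (w (~~ s)), e t y].
have L_gt1 : 1 < #|~: [set ka; kp]|.
  by rewrite cardsC2 // -ltnS prednK // (ltn_trans _ d_ge3).
have [t0|noA] := pickP [predI branch (r s) p & A]; last first.
  have [f f_bij] := bij_between_exists ka card_eq.
  exists f => // t y tW yY ty; case/negP: (negbT (noA t)).
  by rewrite inE /= tW; apply/exists_inP; exists y.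
rewrite /A => /andP[t0W /exists_inP[y0 y0Y ty0]].
have [k kL kn] : exists2 k, k \in ~: [set ka; kp] & k != fY y0.
  case/card_gt1P: L_gt1 => k1 [k2 [k1L k2L k12]].
  have [k1E|k1n] := eqVneq k1 (fY y0); last by exists k1.
  by exists k2; rewrite // -k1E eq_sym.
have [f f_bij ft0] := bij_between_exists1 card_eq t0W kL.
exists f => // t y tW yY ty.
have [-> ->] := branch_edge_unique pU tW t0W yY y0Y ty ty0.
by rewrite ft0.
Qed.

End Existence.

(** * Compatibility of the color pieces and domination in the completed coloring *)

Section Consistency.

Variables (C : finType) (a b : bool -> C) (fU fY : bool -> T -> C).
Variable fW : bool -> T -> T -> C.

Hypothesis a_neq : forall s, a s != a (~~ s).
Hypothesis b_neq : forall s, b s != b (~~ s).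
Hypothesis no_common_nbr : forall s t, e (w s) t -> ~~ e (w (~~ s)) t.
Hypothesis fU_bij : forall s,
  bij_between (fU s) (branch (r (~~ s)) (r s)) (~: [set a s; a (~~ s)]).
Hypothesis fU_q : forall s, fU s (q s) = b s.
Hypothesis fY_bij : forall s,
  bij_between (fY s) (branch (q s) (w s)) (~: [set a (~~ s); b s]).
Hypothesis fY_W : forall s y t,
  y \in branch (q s) (w s) -> t \in branch (r (~~ s)) (q (~~ s)) -> e y t ->
  fY s y = a s.
Hypothesis fY_Y : forall s y z,
  y \in branch (q s) (w s) -> z \in branch (q (~~ s)) (w (~~ s)) -> e y z ->
  fY s y \in pred2 (a s) (b (~~ s)).
Hypothesis fW_bij : forall s p, p \in branch (r (~~ s)) (r s) ->
  bij_between (fW s p) (branch (r s) p) (~: [set a s; fU s p]).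
Hypothesis fW_w : forall s, fW s (q s) (w s) = a (~~ s).
Hypothesis fW_Y : forall s p t y, p \in branch (r (~~ s)) (r s) -> p != q s ->
  t \in branch (r s) p -> y \in branch (q (~~ s)) (w (~~ s)) -> e t y ->
  fW s p t != fY (~~ s) y.

(* The colors [a], [fU], [fW], [fY] of the roots, of their other neighbors, of
   the grandchildren [t] with parent [p], and of the children of [w s]. *)
Inductive piece s : T -> C -> Prop :=
| PieceR : piece s (r s) (a s)
| PieceU t of t \in branch (r (~~ s)) (r s) : piece s t (fU s t)
| PieceW p t of p \in branch (r (~~ s)) (r s) & t \in branch (r s) p :
    piece s t (fW s p t)
| PieceY t of t \in branch (q s) (w s) : piece s t (fY s t).

(** The two hypotheses of [greedy_extension], single-valuedness and properness, for one pair of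
    assignments. *)
Definition consistent (t : T) (k : C) t' k' : Prop :=
  (t = t' -> k = k') /\ (e t t' -> k != k').

Lemma consistent_sym t k t' k' : consistent t k t' k' -> consistent t' k' t k.
Proof.
case=> same adj; split=> [/esym/same//|]; rewrite e_sym eq_sym; exact: adj.
Qed.

Lemma consistent_edge t k t' k' : e t t' -> k != k' -> consistent t k t' k'.
Proof. by move=> tt' kk'; split=> [tE|//]; rewrite tE e_irr in tt'. Qed.

(** The ends of a walk with two to five edges are distinct and nonadjacent, so any colors [k], [k']
    will do. This settles most pairs of pieces. *)
Lemma consistent_nb_walk k k' x y z s :
  nb_walk e x y (z :: s) -> size s < 4 -> consistent x k (last z s) k'.
Proof.
move=> nbw lt4; split=> [xz|]; last by rewrite (negPf (nb_walk_nedge nbw lt4)).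
have := nb_walk_neq nbw; rewrite /= xz eqxx => /(_ _)/negP; case=> //.
by rewrite ltnS (leq_trans lt4).
Qed.

Lemma b_notin_a s s' : b s != a s'.
Proof.
have := bij_between_mem (fU_bij s) (q_in s).
rewrite fU_q !inE negb_or => /andP[bs bs'].
by case: (eqVneq s s') => [<-//|]; case: s s' bs bs' => [] [].
Qed.

Lemma side_cases s s' : {s' = s} + {s' = ~~ s}.
Proof. by case: s; case: s'; [left|right|right|left]. Qed.

Lemma piece_consistent_RR s s' : consistent (r s) (a s) (r s') (a s').
Proof.
have [sE|sE] := side_cases s s'; subst s'; first by split=> //; rewrite e_irr.
exact: consistent_edge.
Qed.

Lemma piece_consistent_R s s' t k : piece s' t k -> consistent (r s) (a s) t k.
Proof.
case=> {t k} [|t|p t|t].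
- exact: piece_consistent_RR.
- move=> tU; have := bij_between_mem (fU_bij s') tU.
  move: tU; rewrite !inE negb_or => /andP[tr' rt] /andP[ka ka'].
  have [sE|sE] := side_cases s s'; subst s'.
    by apply: consistent_edge; rewrite // eq_sym.
  rewrite negbK in tr'.
  apply: (@consistent_nb_walk _ _ _ (r (~~ s)) t [::]) => //; nbw.
- rewrite !in_branch => /andP[pr' rp] /andP[tr pt].
  have [sE|sE] := side_cases s s'; subst s'.
    apply: (@consistent_nb_walk _ _ _ p t [::]) => //; nbw.
  rewrite negbK in pr'.
  apply: (@consistent_nb_walk _ _ _ (r (~~ s)) p [:: t]) => //; nbw.
- rewrite !in_branch => /andP[tq wt].
  have [sE|sE] := side_cases s s'; subst s'.
    apply: (@consistent_nb_walk _ _ _ (q s) (w s) [:: t]) => //; nbw.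
  apply: (@consistent_nb_walk _ _ _ (r (~~ s)) (q (~~ s)) [:: w (~~ s); t]) => //.
  nbw.
Qed.

Lemma piece_consistent_UU s s' t t' :
    t \in branch (r (~~ s)) (r s) -> t' \in branch (r (~~ s')) (r s') ->
  consistent t (fU s t) t' (fU s' t').
Proof.
rewrite !in_branch => /andP[tr rt] /andP[tr' rt'].
have [sE|sE] := side_cases s s'; subst s'.
  have [->|tt'] := eqVneq t t'; first by split=> //; rewrite e_irr.
  apply: (@consistent_nb_walk _ _ _ (r s) t' [::]) => //; nbw.
rewrite negbK in tr'.
apply: (@consistent_nb_walk _ _ _ (r s) (r (~~ s)) [:: t']) => //; nbw.
Qed.

Lemma piece_consistent_UW s s' u p t : u \in branch (r (~~ s)) (r s) ->
    p \in branch (r (~~ s')) (r s') -> t \in branch (r s') p ->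
  consistent u (fU s u) t (fW s' p t).
Proof.
move=> uU pU tW; have := bij_between_mem (fW_bij pU) tW; move: uU pU tW.
rewrite !in_branch => /andP[ur ru] /andP[pr rp] /andP[tr pt].
have [sE|sE] := side_cases s s'; subst s' => kW.
  have [pu|pu] := eqVneq p u.
    subst p; apply: consistent_edge => //.
    by move: kW; rewrite !inE negb_or => /andP[_]; rewrite eq_sym.
  apply: (@consistent_nb_walk _ _ _ (r s) p [:: t]) => //; nbw.
rewrite negbK in pr.
apply: (@consistent_nb_walk _ _ _ (r s) (r (~~ s)) [:: p; t]) => //; nbw.
Qed.

Lemma piece_consistent_UY s s' u y : u \in branch (r (~~ s)) (r s) ->
  y \in branch (q s') (w s') -> consistent u (fU s u) y (fY s' y).
Proof.
rewrite !in_branch => /andP[ur ru] /andP[yq wy].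
have [sE|sE] := side_cases s s'; subst s'.
  have [uq|uq] := eqVneq u (q s).
    subst u; apply: (@consistent_nb_walk _ _ _ (w s) y [::]) => //; nbw.
  apply: (@consistent_nb_walk _ _ _ (r s) (q s) [:: w s; y]) => //; nbw.
apply: (@consistent_nb_walk _ _ _ (r s) (r (~~ s)) [:: q (~~ s); w (~~ s); y]) => //.
nbw.
Qed.

Lemma piece_consistent_WW s s' p t p' t' : p \in branch (r (~~ s)) (r s) ->
    t \in branch (r s) p -> p' \in branch (r (~~ s')) (r s') ->
    t' \in branch (r s') p' ->
  consistent t (fW s p t) t' (fW s' p' t').
Proof.
rewrite !in_branch.
move=> /andP[pr rp] /andP[tr pt] /andP[pr' rp'] /andP[tr' pt'].
have [sE|sE] := side_cases s s'; subst s'.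
  have [pp|pp] := eqVneq p p'.
    subst p'; have [->|tt] := eqVneq t t'; first by split=> //; rewrite e_irr.
    apply: (@consistent_nb_walk _ _ _ p t' [::]) => //; nbw.
  apply: (@consistent_nb_walk _ _ _ p (r s) [:: p'; t']) => //; nbw.
rewrite negbK in pr'.
apply: (@consistent_nb_walk _ _ _ p (r s) [:: r (~~ s); p'; t']) => //; nbw.
Qed.

Lemma piece_consistent_WY s s' p t y : p \in branch (r (~~ s)) (r s) ->
    t \in branch (r s) p -> y \in branch (q s') (w s') ->
  consistent t (fW s p t) y (fY s' y).
Proof.
move=> pU tW yY; move: (pU) (tW) (yY); rewrite !in_branch.
move=> /andP[pr rp] /andP[tr pt] /andP[yq wy].
have [sE|sE] := side_cases s s'; subst s'.
  have [pq|pq] := eqVneq p (q s).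
    subst p; have [tw|tw] := eqVneq t (w s).
      subst t; apply: consistent_edge => //; rewrite fW_w eq_sym.
      by have := bij_between_mem (fY_bij s) yY; rewrite !inE negb_or => /andP[].
    apply: (@consistent_nb_walk _ _ _ (q s) (w s) [:: y]) => //; nbw.
  apply: (@consistent_nb_walk _ _ _ p (r s) [:: q s; w s; y]) => //; nbw.
(* On opposite sides the walk from [t] to [y] has six edges: the two vertices are distinct, but an
   edge may close a 7-cycle. The choice of colors then decides. *)
split=> [ty|ty].
  have : t != y.
    apply: (@nb_walk_neq t p [:: r s; r (~~ s); q (~~ s); w (~~ s); y]) => //.
    nbw.
  by rewrite ty eqxx.
have [pq|pq] := eqVneq p (q s); last exact: fW_Y.
(* Here [y] has color [a (~~ s)], which [fW s (q s)] takes only at [w s]. Equal colors would make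
   [t] the tip [w s], and [y] a common neighbor of the tips. *)
subst p; rewrite (@fY_W (~~ s) y t) ?negbK //; last by rewrite e_sym.
rewrite -fW_w; apply/negP => /eqP/(proj1 (fW_bij pU)) tw.
by have := no_common_nbr wy; rewrite negbK -(tw tW (w_in s)) ty.
Qed.

Lemma piece_consistent_YY s s' y z :
    y \in branch (q s) (w s) -> z \in branch (q s') (w s') ->
  consistent y (fY s y) z (fY s' z).
Proof.
move=> yY zY; move: (yY) (zY); rewrite !in_branch => /andP[yq wy] /andP[zq wz].
have [sE|sE] := side_cases s s'; subst s'.
  have [->|yz] := eqVneq y z; first by split=> //; rewrite e_irr.
  apply: (@consistent_nb_walk _ _ _ (w s) z [::]) => //; nbw.
split=> [yz|yz]; first by have := no_common_nbr wy; rewrite yz wz.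
(* Across an edge, [y] has color [a s] or [b (~~ s)], and [z] has color [a (~~ s)] or [b s]; these
   pairs are disjoint. *)
have := fY_Y yY zY yz; have := @fY_Y (~~ s) z y zY.
rewrite negbK e_sym => /(_ yY yz) /pred2P[] -> /pred2P[] -> //.
- exact: b_notin_a.
- by rewrite eq_sym b_notin_a.
- by rewrite eq_sym.
Qed.

Lemma piece_consistent s s' t k t' k' :
  piece s t k -> piece s' t' k' -> consistent t k t' k'.
Proof.
case=> {t k} [|t tU|p t pU tW|t tY].
- exact: piece_consistent_R.
- case=> {t' k'} [|t' t'U|p' t' p'U t'W|t' t'Y].
  + by apply/consistent_sym/piece_consistent_R/PieceU.
  + exact: piece_consistent_UU.
  + exact: piece_consistent_UW.
  + exact: piece_consistent_UY.
- case=> {t' k'} [|t' t'U|p' t' p'U t'W|t' t'Y].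
  + by apply/consistent_sym/piece_consistent_R/PieceW.
  + exact/consistent_sym/piece_consistent_UW.
  + exact: piece_consistent_WW.
  + exact: piece_consistent_WY.
- case=> {t' k'} [|t' t'U|p' t' p'U t'W|t' t'Y].
  + by apply/consistent_sym/piece_consistent_R/PieceY.
  + exact/consistent_sym/piece_consistent_UY.
  + exact/consistent_sym/piece_consistent_WY.
  + exact: piece_consistent_YY.
Qed.

(** Boolean form of [piece] on either side, to be passed to [greedy_extension]. *)
Definition pieceb t k : bool := [exists s, [|| (t == r s) && (k == a s),
  (t \in branch (r (~~ s)) (r s)) && (k == fU s t),
  [exists p, [&& p \in branch (r (~~ s)) (r s), t \in branch (r s) p &
              k == fW s p t]] |
  (t \in branch (q s) (w s)) && (k == fY s t)]].

Lemma piecebP t k : reflect (exists s, piece s t k) (pieceb t k).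
Proof.
apply: (iffP existsP) => -[s]; last first.
  case=> {t k} [|t tU|p t pU tW|t tY]; exists s; apply/or4P.
  - by apply: Or41; rewrite !eqxx.
  - by apply: Or42; rewrite tU eqxx.
  - by apply: Or43; apply/existsP; exists p; rewrite pU tW eqxx.
  - by apply: Or44; rewrite tY eqxx.
case/or4P=> [/andP[/eqP-> /eqP->]|/andP[tU /eqP->]|/existsP[p]|/andP[tY /eqP->]].
- by exists s; apply: PieceR.
- by exists s; apply: PieceU.
- by case/and3P=> pU tW /eqP->; exists s; apply: PieceW.
- by exists s; apply: PieceY.
Qed.

Variable d : nat.
Hypothesis e_reg : regular_graph e d.
Hypothesis card_C : #|C| = d.+1.

(** The vertices [v] and [u] show their own colors; the other neighbors of [v] show all the
    remaining ones through [f]. *)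
Lemma bij_cdv (c : {ffun T -> C}) v u f :
    e v u -> bij_between f (branch u v) (~: [set c v; c u]) ->
    {in branch u v, c =1 f} ->
  cdv e c v.
Proof.
move=> vu f_bij cf; apply/subsetP=> k _; apply/imsetP.
have [->|kv] := eqVneq k (c v); first by exists v; rewrite ?setU11.
have [->|ku] := eqVneq k (c u); first by exists u; rewrite // !inE vu orbT.
have [|t tB <-] := bij_between_onto f_bij (_ : k \in _).
  by rewrite !inE negb_or kv.
exists t; last by rewrite cf.
by move: tB; rewrite !inE => /andP[_ ->]; rewrite orbT.
Qed.

Lemma exists_doubly_dominating_coloring :
  exists2 c : {ffun T -> C}, proper_coloring e c &
    forall k, 1 < #|[set v in color_class c k | cdv e c v]|.
Proof.
have [|||c c_proper c_piece] := @greedy_extension T C e e_sym e_irr _ pieceb.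
- by move=> v; rewrite e_reg card_C.
- move=> t k k' /piecebP[s st] /piecebP[s' s't].
  by have [kk _] := piece_consistent st s't; apply: kk.
- move=> t t' k tt' /piecebP[s st] /piecebP[s' s't].
  by have [_ /(_ tt')] := piece_consistent st s't; rewrite eqxx.
exists c => // k.
have {}c_piece s t j : piece s t j -> c t = j.
  by move=> st; apply: c_piece; apply/piecebP; exists s.
have cR s : c (r s) = a s by apply: c_piece (PieceR s).
have cU s t : t \in branch (r (~~ s)) (r s) -> c t = fU s t.
  by move=> tU; apply: c_piece (PieceU tU).
have cW s p t : p \in branch (r (~~ s)) (r s) -> t \in branch (r s) p ->
    c t = fW s p t.
  by move=> pU tW; apply: c_piece (PieceW pU tW).
have cY s t : t \in branch (q s) (w s) -> c t = fY s t.
  by move=> tY; apply: c_piece (PieceY tY).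
have cw s : c (w s) = a (~~ s) by rewrite (cW s (q s)).
have cq s : c (q s) = b s by rewrite (cU s) // fU_q.
(* [bij_cdv] is used with [u] the opposite root for [r s], the root [r s] for its other neighbors,
   and [q s] for [w s]. *)
have cdvR s : cdv e c (r s).
  apply: (@bij_cdv c _ (r (~~ s)) (fU s)) => //; last exact: cU.
  by rewrite !cR.
have cdvU s t : t \in branch (r (~~ s)) (r s) -> cdv e c t.
  move=> tU; apply: (@bij_cdv c _ (r s) (fW s t)); last by move=> u; apply: cW.
    by move: tU; rewrite in_branch e_sym => /andP[].
  by rewrite cR (cU s) // setUC; apply: fW_bij.
have cdvW s : cdv e c (w s).
  apply: (@bij_cdv c _ (q s) (fY s)) => //; last exact: cY.
    by rewrite e_sym.
  by rewrite cw cq.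
(* The color [a s] is dominated at [r s] and at the opposite tip; any other color, at one non-root
   neighbor of each root. *)
have [/existsP[s /eqP->]|/existsPn ka] := boolP [exists s, k == a s].
  apply/card_gt1P; exists (r s), (w (~~ s)); split.
  - by rewrite !inE cR eqxx cdvR.
  - by rewrite !inE cw negbK eqxx cdvW.
  - apply: (@nb_walk_neq (r s) (r (~~ s)) [:: q (~~ s); w (~~ s)]) => //; nbw.
have kL s : k \in ~: [set a s; a (~~ s)] by rewrite !inE negb_or !ka.
have [t tU tk] := bij_between_onto (fU_bij true) (kL true).
have [u uU uk] := bij_between_onto (fU_bij false) (kL false).
apply/card_gt1P; exists t, u; split.
- by rewrite !inE (cU true) // tk eqxx (cdvU true).
- by rewrite !inE (cU false) // uk eqxx (cdvU false).
- move: tU uU; rewrite !in_branch /= => /andP[tr rt] /andP[ur ru].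
  have := r_edge true => /= rr.
  apply: (@nb_walk_neq t (r true) [:: r false; u]) => //; nbw.
Qed.

End Consistency.
End Skeleton.
End LocalStructure.

(** * Choice of roots, tips and colors, and conclusion *)

Theorem theorem5p3 (T : finType) (e : rel T) (d g : nat)
    (e_simple : simple_graph e) (e_conn : connected_graph e)
    (d_ge3 : 3 <= d) (e_reg : regular_graph e d)
    (e_girth : is_girth e g) (g_ge7 : 7 <= g) :
  realizes e (nseq d.+1 2).
Proof.
case: e_simple e_conn e_girth => e_sym e_irr [T_gt0 _] [_ long_cycles].
split.
  rewrite /positive_nonincreasing all_nseq orbT andbT.
  (* Prepending a 2 makes the induction uniform. *)
  by apply: (@path_sorted _ _ 2); elim: (d.+1) => //= n ->; rewrite leqnn.
set C := 'I_(size (nseq d.+1 2)).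
have card_C : #|C| = d.+1 by rewrite card_ord size_nseq.
suff [c c_proper c_cdv] : exists2 c : {ffun T -> C}, proper_coloring e c &
    forall k, 1 < #|[set v in color_class c k | cdv e c v]|.
  have has_cdv k : exists2 v, v \in color_class c k & cdv e c v.
    have /card_gt0P[v] := ltnW (c_cdv k).
    by rewrite inE => /andP[vk v_cdv]; exists v.
  exists c; split=> [||i]; first by split.
    (* A dominating vertex of color [k] also witnesses that [k] is used. *)
    apply/setP=> k; rewrite inE; apply/imsetP.
    by have [v] := has_cdv k; rewrite inE => /eqP<- _; exists v.
  have i_lt : i < d.+1 by apply: leq_trans (ltn_ord i) _; rewrite size_nseq.
  by rewrite nth_nseq i_lt.
have /card_gt0P[r0 _] := T_gt0.
have /card_gt0P[r1] : 0 < #|open_nbhd e r0| by rewrite e_reg (ltn_trans _ d_ge3).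
rewrite inE => r01.
pose r s := if s then r1 else r0.
have r_edge s : e (r s) (r (~~ s)) by case: s; rewrite // e_sym.
have cardB := card_branch e_sym e_reg; have cardL := cardsC2 card_C.
have d1_gt1 : 1 < d.-1 by rewrite -ltnS prednK // (ltn_trans _ d_ge3).
(* Two colors for the roots and two for their neighbors [q s]. *)
have /card_geqP[abs [abs_uniq abs_size _]] : 4 <= #|C| by rewrite card_C.
case: abs abs_size abs_uniq => [|a0 [|a1 [|b0 [|b1 [|? ?]]]]] // _ abs_uniq.
pose a s := if s then a1 else a0; pose b s := if s then b1 else b0.
have ab_uniq s : uniq [:: a s; a (~~ s); b s; b (~~ s)].
  move: abs_uniq; rewrite /= !inE !negb_or !andbT.
  case/and3P=> /and3P[a01 a0b0 a0b1] /andP[a1b0 a1b1] b01.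
  by case: s; rewrite /= ?a01 ?a0b0 ?a0b1 ?a1b0 ?a1b1 ?b01 // eq_sym a01 eq_sym b01.
have [/all_and3[a_neq ab ab'] b_neq] : (forall s,
    [/\ a s != a (~~ s), a s != b s & a (~~ s) != b s]) /\ forall s, b s != b (~~ s).
  split=> s; have := ab_uniq s; rewrite /= !inE !negb_or !andbT.
    by case/and3P=> /and3P[-> -> _] /andP[-> _] _.
  by case/and3P.
(* The bijections come first; [q s] is then the vertex at which [fU s] takes the value [b s]. *)
have [fU /all_and2[fU_bij fU_q]] : exists fU, forall s,
    bij_between (fU s) (branch e (r (~~ s)) (r s)) (~: [set a s; a (~~ s)]) /\
    exists2 q, q \in branch e (r (~~ s)) (r s) & fU s q = b s.
  apply: (@fin_all_exists _ _
    (fun s f => bij_between f _ _ /\ exists2 q, _ & f q = b s)) => s.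
  have card_eq : #|branch e (r (~~ s)) (r s)| = #|~: [set a s; a (~~ s)]|.
    by rewrite cardB ?cardL // e_sym.
  have [f f_bij] := bij_between_exists (a s) card_eq.
  exists f; split=> //; apply: bij_between_onto f_bij _.
  by rewrite !inE negb_or eq_sym ab eq_sym ab'.
have [q q_in {}fU_q] : exists2 q, (forall s, q s \in branch e (r (~~ s)) (r s))
    & forall s, fU s (q s) = b s.
  by have /fin_all_exists2[q q_in q_b] := fU_q; exists q.
have rq s : e (r s) (q s) by have := q_in s; rewrite in_branch => /andP[].
have [w0 w0_in] : exists w, forall s, w s \in branch e (r s) (q s).
  apply: (@fin_all_exists _ _ (fun s t => t \in branch e (r s) (q s))) => s.
  by apply/card_gt0P; rewrite cardB // ltnW.
have [|w1 w1_in w1_far] := far_tip_exists e_sym e_irr long_cycles g_ge7 r_edge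
  q_in w0_in (s := true).
  by rewrite cardB.
(* The tip on the [true] side is replaced by one sharing no neighbor with the tip on the [false]
   side. *)
pose w s := if s then w1 else w0 false.
have w_in s : w s \in branch e (r s) (q s).
  by case: s; [exact: w1_in | exact: (w0_in false)].
have no_common_nbr s t : e (w s) t -> ~~ e (w (~~ s)) t.
  by case: s => /=; [apply: contraTN => /w1_far | apply: w1_far].
have /fin_all_exists[fY /all_and3[fY_bij fY_W fY_Y]] :=
  fun s => exists_tip_children_colors
  e_sym e_irr long_cycles g_ge7 r_edge q_in w_in e_reg card_C s (ab_uniq s).
(* Finite choice ranges over all vertices [p], hence the conditional form; outside the branch a
   constant function serves. *)
pose fW_spec s p (f : T -> C) := p \in branch e (r (~~ s)) (r s) ->
  [/\ bij_between f (branch e (r s) p) (~: [set a s; fU s p]),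
    p = q s -> f (w s) = a (~~ s) &
    p != q s -> forall t y, t \in branch e (r s) p ->
      y \in branch e (q (~~ s)) (w (~~ s)) -> e t y -> f t != fY (~~ s) y].
have /fin_all_exists[fW fWP] : forall s, exists fW, forall p, fW_spec s p (fW p).
  move=> s; apply: (@fin_all_exists T (fun=> T -> C) (fW_spec s)) => p.
  have [pU|pU] := boolP (p \in branch e (r (~~ s)) (r s)); last first.
    by exists (fun=> a s) => pU'; case/negP: pU.
  have [->|pq] := eqVneq p (q s).
    have [|f f_bij fw] :=
      exists_grandchild_colors_tip e_sym q_in w_in e_reg card_C s (ab s) _ (ab' s).
      by rewrite eq_sym a_neq.
    by exists f => _; rewrite fU_q eqxx; split.
  have afU : a s != fU s p.
    have := bij_between_mem (fU_bij s) pU.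
    by rewrite !inE negb_or eq_sym => /andP[].
  have [f f_bij fYn] := exists_grandchild_colors e_sym e_irr long_cycles g_ge7
    r_edge q_in w_in d_ge3 e_reg card_C (fY (~~ s)) afU pU.
  by exists f => _; split=> // /eqP; rewrite (negPf pq).
have [|||k_proper] := @exists_doubly_dominating_coloring T e g e_sym e_irr
  long_cycles g_ge7 r q w r_edge q_in w_in C a b fU fY fW a_neq b_neq no_common_nbr
  fU_bij fU_q fY_bij fY_W fY_Y _ _ _ d e_reg card_C.
- by move=> s p /fWP[].
- by move=> s; have [_ -> //] := fWP s _ (q_in s).
- by move=> s p t y /fWP[_ _ fYn] pq; apply: fYn.
by exists k_proper.
Qed.
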